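(* For every integer $n \geq 1$ and every function $f : \{-1,1\}^{n} \to \mathbb{R}$ we have $$\Re\, \mathbb{E}\, (f + i\, |\nabla f|)^{3/2} \leq \Re\, (\mathbb{E} f)^{3/2},$$ where $z^{3/2}$ for $z = x+iy$ is taken with the principal branch and $\Re$ denotes the real part.
   Context: The Hamming cube $\{-1,1\}^n$ is equipped with the uniform (normalized counting) probability measure, and $\mathbb{E}$ is expectation with respect to it: $\mathbb{E} h = 2^{-n}\sum_{x\in\{-1,1\}^n} h(x)$. For $f:\{-1,1\}^n\to\mathbb{R}$, $x=(x_1,\dots,x_n)\in\{-1,1\}^n$ and $1\le j\le n$, the directional derivative is $$\nabla_j f(x) = \frac12\Big(f(x_1,\dots,x_{j-1},1,x_{j+1},\dots,x_n) - f(x_1,\dots,x_{j-1},-1,x_{j+1},\dots,x_n)\Big),$$ the gradient is $\nabla f = (\nabla_1 f,\dots,\nabla_n f)$, and $|\nabla f(x)| \ge 0$ is defined by $|\nabla f(x)|^2 = \sum_{j=1}^n |\nabla_j f(x)|^2$. The principal branch of $z^{3/2}$ is taken with $\arg(z)\in(-\pi,\pi]$ (so that $z^{3/2}=|z|^{3/2}e^{\frac{3}{2} i\arg z}$ for $z\neq 0$, and $0^{3/2}=0$). *)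

(* Defs.v *)
From HB Require Import structures.
From mathcomp Require Import all_boot all_order all_algebra.
From mathcomp Require Import all_classical all_reals all_analysis.
From mathcomp Require Import complex.

Set Implicit Arguments.
Unset Strict Implicit.
Unset Printing Implicit Defensive.

Import Order.TTheory GRing.Theory Num.Theory Normc.

Local Open Scope ring_scope.
Local Open Scope complex_scope.

(** The cube {-1, 1}^n: a vertex is encoded by its sign pattern, where [true]
    stands for the coordinate 1 and [false] for the coordinate -1. *)
Definition cube (n : nat) := {ffun 'I_n -> bool}.

Definition set_coord (n : nat) (x : cube n) (j : 'I_n) (b : bool) : cube n :=
  [ffun k => if k == j then b else x k].

(** The field is a parameter so that both real and complex valued functions
    can be averaged. *)
Definition expect (K : fieldType) (n : nat) (h : cube n -> K) : K :=
  2 ^- n * \sum_(x : cube n) h x.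

Definition pderiv (R : realType) (n : nat) (f : cube n -> R) (j : 'I_n)
    (x : cube n) : R :=
  (f (set_coord x j true) - f (set_coord x j false)) / 2.

Definition grad (R : realType) (n : nat) (f : cube n -> R) (x : cube n) :
    'rV[R]_n :=
  \row_(j < n) pderiv f j x.

(** Mathcomp's norm on row vectors is the sup norm, hence this definition. *)
Definition euclid_norm (R : realType) (n : nat) (v : 'rV[R]_n) : R :=
  Num.sqrt (\sum_(j < n) `|v 0 j| ^+ 2).

(** Principal argument, in ]-pi, pi]; see [carg_bounds] and [carg_polar].  Its
    value at 0 is irrelevant. *)
Definition carg (R : realType) (z : R[i]) : R :=
  let t := acos (complex.Re z / normc z) in
  if 0 <= complex.Im z then t else - t.

(** Principal branch of z^a.  Since [0 `^ a = 0] for a != 0, this gives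
    0^a = 0 for such a. *)
Definition cpow (R : realType) (z : R[i]) (a : R) : R[i] :=
  (normc z `^ a)%:C * (cos (a * carg z) +i* sin (a * carg z)).

Lemma normc_gt0 (R : realType) (z : R[i]) : z != 0 -> 0 < normc z.
Proof.
move=> z0; rewrite lt0r; apply/andP; split.
  by apply: contra z0 => /eqP/eq0_normc ->.
by case: z {z0} => a b; rewrite /= sqrtr_ge0.
Qed.

Lemma sqr_normc (R : realType) (z : R[i]) :
  normc z ^+ 2 = complex.Re z ^+ 2 + complex.Im z ^+ 2.
Proof. by case: z => a b; rewrite /= sqr_sqrtr// addr_ge0// sqr_ge0. Qed.

Lemma Re_div_normc_bound (R : realType) (z : R[i]) :
  z != 0 -> -1 <= complex.Re z / normc z <= 1.
Proof.
move=> z0; have c0 := normc_gt0 z0.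
rewrite -ler_norml normrM normfV (gtr0_norm c0) ler_pdivrMr// mul1r.
by case: z {z0 c0} => a b /=; rewrite -sqrtr_sqr ler_wsqrtr// lerDl sqr_ge0.
Qed.

Lemma carg_bounds (R : realType) (z : R[i]) :
  z != 0 -> - pi < carg z <= pi.
Proof.
move=> z0; have c0 := normc_gt0 z0; have zB := Re_div_normc_bound z0.
have /andP[zB1 zB2] := zB; have pi0 := pi_gt0 R.
rewrite /carg; case: ifPn => [_|].
  by rewrite acos_lepi// andbT (lt_le_trans _ (acos_ge0 zB))// oppr_lt0.
rewrite -ltNge => Im0.
rewrite ltrN2 (le_trans _ (ltW pi0)) ?oppr_le0 ?acos_ge0// andbT.
rewrite acos_ltpi// zB2 andbT lt_neqAle zB1 andbT eq_sym.
apply/negP => /eqP E.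
have : complex.Re z = - normc z by rewrite -[LHS](divfK (lt0r_neq0 c0)) E mulN1r.
move=> /(congr1 (fun t => t ^+ 2)); rewrite sqrrN sqr_normc => /eqP.
by rewrite -subr_eq0 opprD addrA subrr sub0r oppr_eq0 sqrf_eq0 (lt_eqF Im0).
Qed.

Lemma carg_polar (R : realType) (z : R[i]) :
  z != 0 -> z = (normc z)%:C * (cos (carg z) +i* sin (carg z)).
Proof.
move=> z0; have c0 := normc_gt0 z0; have zB := Re_div_normc_bound z0.
have cN0 := lt0r_neq0 c0.
have cosE : cos (carg z) = complex.Re z / normc z.
  by rewrite /carg; case: ifP => _; rewrite ?cosN acosK// in_itv.
have sinE : sin (carg z) = complex.Im z / normc z.
  have E : sin (acos (complex.Re z / normc z)) = `|complex.Im z| / normc z.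
    rewrite sin_acos//.
    have -> : 1 - (complex.Re z / normc z) ^+ 2 = (complex.Im z / normc z) ^+ 2.
      rewrite !expr_div_n -(divff (expf_neq0 2 cN0)) -mulrBl.
      by rewrite {1}sqr_normc addrAC subrr add0r.
    by rewrite sqrtr_sqr normrM normfV (gtr0_norm c0).
  rewrite /carg; case: ifPn => [Im0|]; first by rewrite E ger0_norm.
  by rewrite -ltNge => Im0; rewrite sinN E ltr0_norm// mulNr opprK.
rewrite cosE sinE; rewrite {1}(complexE z); move: cN0.
move: (normc z) (complex.Re z) (complex.Im z) => r a b r0.
by simpc; rewrite ![r * _]mulrC !divfK.
Qed.

(* Main.v *)
(** With [z = (u + i v)^2] one has [Re z^(3/2) = u^3 - 3 u v^2], and this is the
    value at its saddle point [(u, v)] of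
      [Phi x y s t = 3/2 (x s - y t) - (s^3 - 3 s t^2) / 2],
    which has a maximum in [s >= 0] and a minimum in [t].  The cubic
    [N s t = s^3 - 3 s t^2] satisfies the four-point identity
      [N (s + b) t' + N (s - b) t' = 2 N s t] with [t' = sqrt (t^2 + b^2)];
    through the saddle point this yields a two-point inequality, by which
    averaging [f] over one coordinate does not decrease
    [E Re (f + i |grad f|)^(3/2)].  Averaging over all coordinates turns [f]
    into the constant [E f]. *)

Require Import Defs.
From mathcomp Require Import all_boot all_order all_algebra.
From mathcomp Require Import all_classical all_reals all_analysis.
From mathcomp Require Import complex.
From mathcomp Require Import ring lra.

Import Order.TTheory GRing.Theory Num.Theory Normc.

Local Open Scope ring_scope.
Local Open Scope complex_scope.

(** * Square-root coordinates and the two-point inequality *)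

(** [u + i v] is the principal square root: for [0 <= y] the argument lies in [0, pi], so its half
    lies in the first quadrant and both coordinates are nonnegative. The cubic is the triple-angle
    formula at that half angle. *)
Lemma Re_cpow32_param (R : realType) (x y : R) : 0 <= y ->
  exists u v : R, [/\ 0 <= u, 0 <= v, x = u ^+ 2 - v ^+ 2, y = 2 * u * v &
    complex.Re (cpow (x +i* y) (3 / 2)) = u ^+ 3 - 3 * u * v ^+ 2].
Proof.
move=> y0; have [z0|z0] := eqVneq (x +i* y) 0.
  exists 0, 0; case: (z0) => -> ->; split=> //; try ring.
  rewrite /cpow /= expr0n /= addr0 sqrtr0 powR0; last by apply/eqP; lra.
  ring.
have c0 := normc_gt0 z0; have zB := Re_div_normc_bound z0.
have t0 : 0 <= carg (x +i* y) by rewrite /carg /= y0 acos_ge0.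
have /andP[_ tpi] := carg_bounds z0.
have := carg_polar z0; rewrite /cpow.
move: (normc (x +i* y)) (carg (x +i* y)) c0 t0 tpi => r t r0 t0 tpi.
set c := cos (t / 2); set s := sin (t / 2); set q := Num.sqrt r.
have qE : q ^+ 2 = r by rewrite sqr_sqrtr // ltW.
have cs : c ^+ 2 + s ^+ 2 = 1 by rewrite cos2Dsin2.
have tE : t = t / 2 + t / 2 by lra.
have cE : cos t = c * c - s * s by rewrite {1}tE cosD.
have sE : sin t = s * c + c * s by rewrite {1}tE sinD.
have c3E : cos (3 / 2 * t) = c ^+ 3 - 3 * c * s ^+ 2.
  rewrite (_ : 3 / 2 * t = t + t / 2); last lra.
  by rewrite cosD cE sE -/c -/s; ring.
have r32 : r `^ (3 / 2) = q ^+ 3.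
  rewrite -[r]qE -powR_mulrn ?sqrtr_ge0// -powRrM -powR_mulrn ?sqrtr_ge0//.
  congr (_ `^ _); lra.
simpc => -[xE yE]; exists (q * c), (q * s); split.
- by rewrite mulr_ge0 ?sqrtr_ge0// cos_ge0_pihalf//; apply/andP; split; lra.
- by rewrite mulr_ge0 ?sqrtr_ge0// sin_ge0_pi//; apply/andP; split; lra.
- by rewrite xE cE -qE; ring.
- by rewrite yE sE -qE; ring.
- by rewrite /= r32 c3E; ring.
Qed.

(** Models an edge of the cube: [x + a] and [x - a] are the values of [f] at its ends, [a] is the
    derivative along it, [p] and [q] are the norms of the other derivatives at the ends, and [y] is
    the gradient norm after averaging. *)
Lemma two_point (R : realType) (x a y p q : R) :
  0 <= y -> 0 <= p -> 0 <= q -> 2 * y <= p + q ->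
  complex.Re (cpow ((x + a) +i* Num.sqrt (a ^+ 2 + p ^+ 2)) (3 / 2)) +
  complex.Re (cpow ((x - a) +i* Num.sqrt (a ^+ 2 + q ^+ 2)) (3 / 2)) <=
  2 * complex.Re (cpow (x +i* y) (3 / 2)).
Proof.
move=> y0 p0 q0 ypq.
have [u [v [u0 v0 xE yE ->]]] := Re_cpow32_param _ x _ y0.
(* Cauchy-Schwarz for the vectors (v, b) and (e, a), by Lagrange's identity. *)
have CS (b e d w : R) : 0 <= d -> 0 <= w -> w ^+ 2 = v ^+ 2 + b ^+ 2 ->
    d ^+ 2 = a ^+ 2 + e ^+ 2 -> v * e + a * b <= w * d.
  move=> d0 w0 wE dE; rewrite (le_trans (ler_norm _))//.
  rewrite -(ler_pXn2r (n := 2))// ?nnegrE ?mulr_ge0// real_normK ?num_real//.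
  rewrite exprMn wE dE -subr_ge0.
  by rewrite (_ : _ - _ = (v * a - b * e) ^+ 2) ?sqr_ge0//; ring.
set d1 := Num.sqrt (a ^+ 2 + p ^+ 2); set d2 := Num.sqrt (a ^+ 2 + q ^+ 2).
have d10 : 0 <= d1 := sqrtr_ge0 _; have d20 : 0 <= d2 := sqrtr_ge0 _.
have d1E : d1 ^+ 2 = a ^+ 2 + p ^+ 2 by rewrite sqr_sqrtr// addr_ge0 ?sqr_ge0.
have d2E : d2 ^+ 2 = a ^+ 2 + q ^+ 2 by rewrite sqr_sqrtr// addr_ge0 ?sqr_ge0.
have [u1 [v1 [u10 v10 x1E y1E ->]]] := Re_cpow32_param _ (x + a) _ d10.
have [u2 [v2 [u20 v20 x2E y2E ->]]] := Re_cpow32_param _ (x - a) _ d20.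
(* Chosen so that [u1 = m + b] and [u2 = m - b]; [w] is then the t' of the four-point identity at
   (m, v). *)
pose b := (u1 - u2) / 2; pose m := (u1 + u2) / 2.
pose w := Num.sqrt (v ^+ 2 + b ^+ 2).
have m0 : 0 <= m by rewrite divr_ge0 ?addr_ge0.
have w0 : 0 <= w := sqrtr_ge0 _.
have wE : w ^+ 2 = v ^+ 2 + b ^+ 2 by rewrite sqr_sqrtr// addr_ge0 ?sqr_ge0.
have H1 := CS b p d1 w d10 w0 wE d1E.
have H2 := CS b q d2 w d20 w0 wE d2E.
pose Phi (x y s t : R) := 3 / 2 * (x * s - y * t) - (s ^+ 3 - 3 * s * t ^+ 2) / 2.
(* Maximality in s at the midpoint: [m] competes with the maximizer [u]. *)
have A : Phi x y m v <= u ^+ 3 - 3 * u * v ^+ 2.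
  rewrite -subr_ge0 (_ : _ - _ = (u - m) ^+ 2 * (2 * u + m) / 2).
    apply: divr_ge0 => //; apply: mulr_ge0; first exact: sqr_ge0.
    by apply: addr_ge0 => //; apply: mulr_ge0.
  by rewrite /Phi xE yE; field.
(* Minimality in t at the endpoints: the common [w] competes with the minimizers [v1] and [v2]. *)
have B (x' d s t : R) : 0 <= s -> x' = s ^+ 2 - t ^+ 2 -> d = 2 * s * t ->
    s ^+ 3 - 3 * s * t ^+ 2 <= Phi x' d s w.
  move=> s0 -> ->; rewrite -subr_ge0 (_ : _ - _ = 3 / 2 * (s * (w - t) ^+ 2)).
    apply: mulr_ge0; first lra.
    by apply: mulr_ge0 => //; apply: sqr_ge0.
  by rewrite /Phi; field.
have B1 := B _ _ _ _ u10 x1E y1E; have B2 := B _ _ _ _ u20 x2E y2E.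
(* The cubic terms match by the four-point identity; the linear ones leave the two Cauchy-Schwarz
   defects and the slack of [2 * y <= p + q]. *)
have E : Phi (x + a) d1 u1 w + Phi (x - a) d2 u2 w =
    2 * Phi x y m v - 3 / 2 * ((w * d1 - (v * p + a * b)) +
      (w * d2 - (v * q + a * b)) + v * (p + q - 2 * y)).
  rewrite (_ : Phi (x + a) d1 u1 w + Phi (x - a) d2 u2 w =
    3 / 2 * ((x + a) * u1 + (x - a) * u2 - w * (d1 + d2))
     - (u1 ^+ 3 + u2 ^+ 3) / 2 + 3 / 2 * (u1 + u2) * w ^+ 2); last by rewrite /Phi; field.
  by rewrite wE /Phi /b /m; field.
have H3 : 0 <= v * (p + q - 2 * y) by rewrite mulr_ge0// subr_ge0.
lra.
Qed.

(** * Averaging on the cube and the Euclidean triangle inequality *)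

Definition avg {R : realType} {n : nat} (k : 'I_n) (h : cube n -> R)
    (x : cube n) : R :=
  (h (set_coord x k true) + h (set_coord x k false)) / 2.

Definition avgs {R : realType} {n : nat} (f : cube n -> R) (s : seq 'I_n) :=
  foldr avg f s.

Definition bellman {R : realType} {n : nat} (f : cube n -> R) (x : cube n) : R :=
  complex.Re (cpow (f x +i* euclid_norm (grad f x)) (3 / 2)).

Lemma set_coordC (n : nat) (x : cube n) (j k : 'I_n) (b c : bool) : j != k ->
  set_coord (set_coord x j b) k c = set_coord (set_coord x k c) j b.
Proof.
move=> jk; apply/ffunP => i; rewrite !ffunE.
by case: (eqVneq i k) => [->|//]; rewrite eq_sym (negPf jk).
Qed.

Lemma set_coordK (n : nat) (x : cube n) (j : 'I_n) (b c : bool) :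
  set_coord (set_coord x j b) j c = set_coord x j c.
Proof. by apply/ffunP => i; rewrite !ffunE; case: eqP. Qed.

Lemma set_coord_id (n : nat) (x : cube n) (j : 'I_n) : set_coord x j (x j) = x.
Proof. by apply/ffunP => i; rewrite !ffunE; case: eqP => // ->. Qed.

Lemma expect_avg (R : realType) (n : nat) (k : 'I_n) (h : cube n -> R) :
  expect (avg k h) = expect h.
Proof.
rewrite /expect; congr (_ * _).
(* Flipping coordinate [k] permutes the cube, and [avg k h] is the mean of [h] and [h] composed with
   this flip. *)
pose flip (x : cube n) := set_coord x k (~~ x k).
have flipK : involutive flip.
  by move=> x; rewrite /flip set_coordK ffunE eqxx negbK set_coord_id.
have E x : avg k h x = (h x + h (flip x)) / 2.
  rewrite /avg /flip -{3}(set_coord_id _ x k); case: (x k) => //=.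
  by rewrite addrC.
rewrite (eq_bigr _ (fun x _ => E x)) -mulr_suml big_split /=.
by rewrite -[X in _ + X](reindex_inj (inv_inj flipK) (P := xpredT) (F := h)) /=; field.
Qed.

Lemma le_expect (R : realType) (n : nat) (g h : cube n -> R) :
  (forall x, g x <= h x) -> expect g <= expect h.
Proof.
move=> gh; rewrite /expect ler_wpM2l ?invr_ge0 ?exprn_ge0//.
by apply: ler_sum => x _; apply: gh.
Qed.

Lemma expect_cst (K : numFieldType) (n : nat) (c : K) :
  expect (fun _ : cube n => c) = c.
Proof.
rewrite /expect sumr_const card_ffun card_bool card_ord -[c *+ _]mulr_natl natrX mulrA.
by rewrite mulVf ?mul1r// expf_neq0// pnatr_eq0.
Qed.

Lemma Re_expect (R : realType) (n : nat) (h : cube n -> R[i]) :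
  complex.Re (expect h) = expect (fun x => complex.Re (h x)).
Proof.
rewrite /expect (_ : 2 ^- n = (2 ^- n : R)%:C); last first.
  by rewrite fmorphV rmorphXn rmorph_nat.
have ReM (a : R) z : complex.Re (a%:C * z) = a * complex.Re z.
  by case: z => b c /=; rewrite mul0r subr0.
rewrite ReM (big_morph (@complex.Re R) (id1 := 0) (op1 := +%R))//.
by move=> [a b] [c d].
Qed.

Lemma sum_sqr_minkowski (R : realType) (I : finType) (P : pred I) (p q : I -> R) :
  Num.sqrt (\sum_(j | P j) (p j + q j) ^+ 2) <=
  Num.sqrt (\sum_(j | P j) p j ^+ 2) + Num.sqrt (\sum_(j | P j) q j ^+ 2).
Proof.
have S0 (r : I -> R) : 0 <= \sum_(j | P j) r j ^+ 2.
  by apply: sumr_ge0 => j _; apply: sqr_ge0.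
set a := Num.sqrt (\sum_(j | P j) p j ^+ 2).
set b := Num.sqrt (\sum_(j | P j) q j ^+ 2).
have a0 : 0 <= a := sqrtr_ge0 _; have b0 : 0 <= b := sqrtr_ge0 _.
have aE : a ^+ 2 = \sum_(j | P j) p j ^+ 2 by rewrite sqr_sqrtr.
have bE : b ^+ 2 = \sum_(j | P j) q j ^+ 2 by rewrite sqr_sqrtr.
have z (r : I -> R) : \sum_(j | P j) r j ^+ 2 = 0 -> forall j, P j -> r j = 0.
  move=> r0 j Pj; apply/eqP; rewrite -sqrf_eq0; apply/eqP.
  by apply: (psumr_eq0P _ r0) => // i _; apply: sqr_ge0.
have CS : \sum_(j | P j) p j * q j <= a * b.
  have [a00|an0] := eqVneq a 0.
    have pz := z p; rewrite -aE a00 expr0n in pz.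
    by rewrite a00 mul0r big1// => j Pj; rewrite (pz erefl j Pj) mul0r.
  have [b00|bn0] := eqVneq b 0.
    have qz := z q; rewrite -bE b00 expr0n in qz.
    by rewrite b00 mulr0 big1// => j Pj; rewrite (qz erefl j Pj) mulr0.
  (* With both norms positive, [2 * a * b] times the Cauchy-Schwarz defect is a sum of squares. *)
  have ab : 0 < a * b by rewrite mulr_gt0 ?lt0r ?an0 ?bn0.
  rewrite -(ler_pM2l ab) -subr_ge0 -(pmulr_rge0 _ (ltr0n R 2)).
  rewrite (_ : 2 * _ = \sum_(j | P j) (b * p j - a * q j) ^+ 2) ?S0//.
  rewrite [RHS](eq_bigr (fun j => b ^+ 2 * p j ^+ 2 + a ^+ 2 * q j ^+ 2
    - 2 * a * b * (p j * q j))); last by move=> j _; ring.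
  by rewrite sumrB big_split /= -!mulr_sumr -aE -bE; ring.
rewrite -(ler_pXn2r (n := 2))// ?nnegrE ?addr_ge0 ?sqrtr_ge0// sqr_sqrtr//.
rewrite (eq_bigr (fun j => p j ^+ 2 + q j ^+ 2 + 2 * (p j * q j))); last first.
  by move=> j _; ring.
rewrite !big_split /= -mulr_sumr -aE -bE -subr_ge0.
rewrite (_ : _ - _ = 2 * (a * b - \sum_(j | P j) p j * q j)); last ring.
by rewrite mulr_ge0// subr_ge0.
Qed.

(** * Monotonicity under averaging *)

Section Step.
Variables (R : realType) (n : nat).
Implicit Types (f : cube n -> R) (x : cube n) (j k : 'I_n).

Lemma pderiv_set_coord f k x b : pderiv f k (set_coord x k b) = pderiv f k x.
Proof. by rewrite /pderiv !set_coordK. Qed.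

Lemma pderiv_avg f j k x : j != k -> pderiv (avg k f) j x = avg k (pderiv f j) x.
Proof.
by move=> jk; rewrite /pderiv /avg !(set_coordC _ x j k _ _)//; field.
Qed.

Lemma pderiv_avg_eq f k x : pderiv (avg k f) k x = 0.
Proof. by rewrite /pderiv /avg !set_coordK subrr mul0r. Qed.

Lemma grad_normE f x k : euclid_norm (grad f x) =
  Num.sqrt (pderiv f k x ^+ 2 + \sum_(j | j != k) pderiv f j x ^+ 2).
Proof.
rewrite /euclid_norm (bigD1 k) //= mxE real_normK ?num_real//; congr Num.sqrt.
by congr (_ + _); apply: eq_bigr => j _; rewrite mxE real_normK ?num_real.
Qed.

(** This is [two_point] on the edge through [x] in direction [k]. The derivative along the edge is
    the same at both ends and vanishes after averaging; Minkowski's inequality on the other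
    coordinates gives [2 * y <= p + q]. *)
Lemma avg_bellman f k x : avg k (bellman f) x <= bellman (avg k f) x.
Proof.
pose xt := set_coord x k true; pose xf := set_coord x k false.
pose p := Num.sqrt (\sum_(j | j != k) pderiv f j xt ^+ 2).
pose q := Num.sqrt (\sum_(j | j != k) pderiv f j xf ^+ 2).
pose y := Num.sqrt (\sum_(j | j != k) avg k (pderiv f j) x ^+ 2).
have S0 (g : 'I_n -> R) : 0 <= \sum_(j | j != k) g j ^+ 2.
  by apply: sumr_ge0 => j _; apply: sqr_ge0.
have ypq : 2 * y <= p + q.
  apply: le_trans (sum_sqr_minkowski _ _ _ _ _).
  rewrite -[2 * y]ger0_norm ?mulr_ge0 ?sqrtr_ge0// -sqrtr_sqr exprMn sqr_sqrtr//.
  rewrite mulr_sumr (eq_bigr (fun j => (pderiv f j xt + pderiv f j xf) ^+ 2))//.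
  by move=> j _; rewrite /avg; field.
have yE : euclid_norm (grad (avg k f) x) = y.
  rewrite (grad_normE _ _ k) pderiv_avg_eq expr0n /= add0r; congr Num.sqrt.
  by apply: eq_bigr => j jk; rewrite pderiv_avg.
have bE b : bellman f (set_coord x k b) = complex.Re (cpow
    (f (set_coord x k b) +i* Num.sqrt (pderiv f k x ^+ 2 +
      Num.sqrt (\sum_(j | j != k) pderiv f j (set_coord x k b) ^+ 2) ^+ 2)) (3 / 2)).
  by rewrite /bellman (grad_normE _ _ k) pderiv_set_coord sqr_sqrtr.
rewrite [avg k (bellman f) x]/avg !bE /bellman yE ler_pdivrMr// [_ * 2]mulrC.
have := two_point R (avg k f x) (pderiv f k x) y p q
  (sqrtr_ge0 _) (sqrtr_ge0 _) (sqrtr_ge0 _) ypq.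
have -> : avg k f x + pderiv f k x = f xt by rewrite /avg /pderiv; field.
have -> : avg k f x - pderiv f k x = f xf by rewrite /avg /pderiv; field.
exact.
Qed.

Lemma expect_avgs f s : expect (avgs f s) = expect f.
Proof. by elim: s => //= k s <-; apply: expect_avg. Qed.

Lemma expect_bellman_avgs f s : expect (bellman f) <= expect (bellman (avgs f s)).
Proof.
elim: s => //= k s IH; apply: (le_trans IH).
(* Averaging the smaller side preserves its expectation and reduces the claim to a pointwise one. *)
by rewrite -(expect_avg _ _ k); apply: le_expect => x; apply: avg_bellman.
Qed.

(** The average over [j] erases coordinate [j], and averages over other coordinates commute with
    setting it. *)
Lemma avgs_set_coord f s j x b : j \in s -> avgs f s (set_coord x j b) = avgs f s x.
Proof.
elim: s x => //= k s IH x; rewrite inE /avg.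
have [->|jk /= js] := eqVneq j k; first by rewrite !set_coordK.
by rewrite !(set_coordC _ x j k _ _)// !IH.
Qed.

Lemma avgs_const f x y : avgs f (enum 'I_n) x = avgs f (enum 'I_n) y.
Proof.
(* Moves from [x] to [y] one coordinate at a time. *)
pose g s := foldr (fun j z => set_coord z j (y j)) x s.
have gE s i : g s i = if i \in s then y i else x i.
  elim: s => //= j s IH; rewrite ffunE inE.
  by case: eqP => [->|] //=; rewrite -/(g s) IH.
have <- : g (enum 'I_n) = y by apply/ffunP => i; rewrite gE mem_enum.
(* Induction only on the list of replaced coordinates; the averages still run over all of them. *)
elim: {3}(enum 'I_n) => //= j s IH.
by rewrite avgs_set_coord ?mem_enum.
Qed.

End Step.

Theorem theorem1 (R : realType) (n : nat) (hn : (1 <= n)%N) (f : cube n -> R) :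
  complex.Re (expect (fun x => cpow (f x +i* euclid_norm (grad f x)) (3 / 2)))
    <= complex.Re (cpow (expect f)%:C (3 / 2)).
Proof.
rewrite Re_expect; apply: (le_trans (expect_bellman_avgs _ _ f (enum 'I_n))).
pose g := avgs f (enum 'I_n).
(* A constant function equals its mean, and averaging has kept the mean of [f]. *)
have gE x : g x = expect f.
  rewrite -(expect_avgs _ _ f (enum 'I_n)) -[LHS](expect_cst _ n).
  by rewrite /expect; congr (_ * _); apply: eq_bigr => y _; apply: avgs_const.
have grad0 x : euclid_norm (grad g x) = 0.
  rewrite /euclid_norm big1 ?sqrtr0// => j _.
  by rewrite mxE /pderiv !gE subrr mul0r normr0 expr0n.
rewrite -[leRHS](expect_cst _ n); apply: le_expect => x.
by rewrite /bellman -/g gE grad0.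
Qed.
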